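(* For any integer $k\ge 1$, the path $P_k$ is a shortest path graph.
   Context: Graphs are finite and simple. $P_k$ denotes the path of length $k$ (with $k+1$ vertices). For a graph $G$ with distinct vertices $a,b$, a shortest $a,b$-path is a path between $a$ and $b$ of length $d_G(a,b)$. The shortest path graph $S(G,a,b)$ is the graph whose vertices are the shortest $a,b$-paths in $G$, two of them being adjacent if and only if the corresponding paths differ in exactly one vertex. A graph $H$ is called a shortest path graph if there exist a graph $G$ and distinct $a,b\in V(G)$ with $S(G,a,b)\cong H$. *)

(* Defs.v *)
From mathcomp Require Import all_boot.
Set Implicit Arguments.
Unset Strict Implicit.
Unset Printing Implicit Defensive.

Record sgraph := SGraph {
  vertex :> finType;
  adj : rel vertex;
  adj_sym : symmetric adj;
  adj_irr : irreflexive adj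
}.

Definition graph_iso (G H : sgraph) : Prop :=
  exists f : G -> H, bijective f /\ {mono f : x y / adj x y}.

(* The path whose vertices, in order from a to b, are a :: p. Its length
   (number of edges) is size p. *)
Definition ab_path (G : sgraph) (a b : G) (p : seq G) : bool :=
  [&& path (@adj G) a p, uniq (a :: p) & last a p == b].

(* The least length of an a,b-path. A path repeats no vertex, so its length is
   less than #|G|; when no a,b-path exists, find returns #|G|, a value which is
   the length of no path. *)
Definition gdist (G : sgraph) (a b : G) : nat :=
  find (fun n => [exists p : n.-tuple G, ab_path a b p]) (iota 0 #|G|).

Definition shortest_path (G : sgraph) (a b : G) : finType :=
  {p : (gdist a b).-tuple G | ab_path a b p}.

(* All shortest a,b-paths have the same length, and the position of a vertex
   on any of them is its distance to a: a vertex common to two of them occupies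
   the same position in both, so differing vertices are counted by position.
   The omitted initial vertex a is common to all of them. *)
Definition sp_adj (G : sgraph) (a b : G) : rel (shortest_path a b) :=
  fun p q => #|[set i | tnth (val p) i != tnth (val q) i]| == 1.

Lemma sp_adj_sym (G : sgraph) (a b : G) : symmetric (@sp_adj G a b).
Proof.
move=> p q; rewrite /sp_adj; congr (#|pred_of_set _| == 1).
by apply/setP => i; rewrite !inE eq_sym.
Qed.

Lemma sp_adj_irr (G : sgraph) (a b : G) : irreflexive (@sp_adj G a b).
Proof.
move=> p; rewrite /sp_adj (_ : [set i | _] = set0) ?cards0 //.
by apply/setP => i; rewrite !inE eqxx.
Qed.

Definition shortest_path_graph (G : sgraph) (a b : G) : sgraph :=
  SGraph (@sp_adj_sym G a b) (@sp_adj_irr G a b).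

Definition is_shortest_path_graph (H : sgraph) : Prop :=
  exists (G : sgraph) (a b : G),
    a != b /\ graph_iso (shortest_path_graph a b) H.

Definition path_adj (k : nat) : rel 'I_k.+1 :=
  fun i j => (i.+1 == j :> nat) || (j.+1 == i :> nat).

Lemma path_adj_sym k : symmetric (@path_adj k).
Proof. by move=> i j; rewrite /path_adj orbC. Qed.

Lemma path_adj_irr k : irreflexive (@path_adj k).
Proof. by move=> i; rewrite /path_adj orbb eqn_leq ltnn. Qed.

Definition path_graph (k : nat) : sgraph :=
  SGraph (@path_adj_sym k) (@path_adj_irr k).

(* Main.v *)
Require Import Defs.
From mathcomp Require Import all_boot.
From mathcomp Require Import zify.

(** Join all even vertices of the path [0, 1, ..., k+1] to a new vertex [a] and
    all odd ones to a new vertex [b]. The shortest [a,b]-paths have length 3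
    and are the [a, i, j, b] with [ij] an edge of the path, [i] even and [j]
    odd. Two of them differ in one vertex iff their edges share an endpoint, so
    the shortest path graph is the line graph of a path with [k+1] edges. *)

Lemma gdist_eq (G : sgraph) (a b : G) (p : seq G) :
  ab_path a b p -> (forall q, ab_path a b q -> size p <= size q) ->
  gdist a b = size p.
Proof.
move=> abp minp; rewrite /gdist; set P := (X in find X).
have Pp : P (size p) by apply/existsP; exists (in_tuple p).
(* With [a] counted, the path has [size p + 1] distinct vertices, so [size p] lies in the range that
   [find] searches. *)
have ltp : size p < #|G|.
  by have /and3P[_ /card_uniqP /= <- _] := abp; exact: max_card.
have hasP' : has P (iota 0 #|G|).
  by apply/hasP; exists (size p); rewrite ?mem_iota.
have lt_find : find P (iota 0 #|G|) < #|G|.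
  by move: hasP'; rewrite has_find size_iota.
apply/eqP; rewrite eqn_leq; apply/andP; split.
  rewrite leqNgt; apply/negP => /(before_find 0).
  by rewrite nth_iota // add0n Pp.
have := nth_find 0 hasP'; rewrite nth_iota // add0n => /existsP[q /minp].
by rewrite size_tuple.
Qed.

(** With [nth] instead of [tnth], explicit entries leave [n] only in the bound of the sum; for [n] a
    [gdist], its value can then be substituted and the sum expanded. *)
Lemma card_tnth_neq (T : eqType) (n : nat) (x0 : T) (s t : n.-tuple T) :
  #|[set i | tnth s i != tnth t i]| =
  \sum_(i < n) (nth x0 s i != nth x0 t i).
Proof.
rewrite -sum1_card big_mkcond; apply: eq_bigr => i _.
by rewrite inE !(tnth_nth x0); case: (_ != _).
Qed.

Section Ladder.

Variable k : nat.

Definition ladder_vertex : finType := ('I_k.+2 + bool)%type.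

Definition ladder_adj : rel ladder_vertex := fun x y =>
  match x, y with
  | inl i, inl j => @path_adj k.+1 i j
  | inl i, inr c | inr c, inl i => odd i == c
  | inr _, inr _ => false
  end.

Lemma ladder_adj_sym : symmetric ladder_adj.
Proof. by move=> [i|c] [j|d] //=; apply: path_adj_sym. Qed.

Lemma ladder_adj_irr : irreflexive ladder_adj.
Proof. by move=> [i|c] //=; apply: path_adj_irr. Qed.

Definition ladder : sgraph := SGraph ladder_adj_sym ladder_adj_irr.

Definition source : ladder := inr false.
Definition target : ladder := inr true.

(* The even, then the odd endpoint of the edge {m, m+1}. *)
Definition edge_path (m : nat) : seq ladder :=
  [:: inl (inord (m + odd m)); inl (inord (m + ~~ odd m)); target].

Lemma edge_path_ab (m : nat) :
  m < k.+1 -> ab_path source target (edge_path m).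
Proof.
move=> ltm; rewrite /ab_path /= !inE /= /path_adj.
have E i j : ((inl i : ladder) == inl j) = (i == j) by [].
have F i : ((inl i : ladder) == target) = false by [].
by rewrite E F eqxx -val_eqE /= !inordK; case: (boolP (odd m)) => om; lia.
Qed.

(** The neighbours of [source] are even and those of [target] odd, so the two have no common
    neighbour, nor are they adjacent. *)
Lemma ab_path_size (p : seq ladder) :
  ab_path source target p -> 2 < size p.
Proof.
by case: p => [|[i|c] [|[j|d] [|? ?]]] //=; rewrite /ab_path //=;
   case: (odd i); try case: d; rewrite ?andbF.
Qed.

Lemma gdist_ladder : gdist source target = 3.
Proof. by apply: (gdist_eq _ _ _ _ (edge_path_ab 0 _)) => // q /ab_path_size. Qed.

Lemma ab_path_edge (p : seq ladder) :
  ab_path source target p -> size p = 3 ->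
  exists2 m, m < k.+1 & p = edge_path m.
Proof.
case: p => [|[i|c] [|[j|d] [|y [|? ?]]]] //; last first.
  (* As [i] is even, a next vertex [inr d] has to be [source], already visited. *)
  by case/and3P=> /=; case: (odd i) => //; case: d => //; rewrite ?andbF.
case/and3P => /= /and4P[/eqP oi ij _ _] _ /eqP -> _.
move: ij (ltn_ord i) (ltn_ord j); rewrite /path_adj => ij lti ltj.
(* Edges are indexed by their smaller endpoint, whose parity tells whether it is [i] or [j]. *)
exists (minn i j); first by lia.
by congr [:: inl _; inl _; _]; apply: val_inj; rewrite /= inordK; lia.
Qed.

Lemma edge_path_size (m : nat) : size (edge_path m) == gdist source target.
Proof. by rewrite gdist_ladder. Qed.

Definition ladder_path (m : path_graph k) : shortest_path source target :=
  Sub (Tuple (edge_path_size m)) (edge_path_ab m (ltn_ord m)).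

Lemma ladder_path_inj : injective ladder_path.
Proof.
move=> m n /(congr1 (fun p => val (val p))) /= [].
move: (ltn_ord m) (ltn_ord n) => ltm ltn.
move=> /(congr1 val) /= + /(congr1 val) /=; rewrite !inordK; try lia.
by move=> e1 e2; apply: val_inj => /=; lia.
Qed.

Lemma ladder_path_surj (p : shortest_path source target) :
  exists m, ladder_path m == p.
Proof.
have [m ltm pm] : exists2 m, m < k.+1 & val (val p) = edge_path m.
  by apply: ab_path_edge (valP p) _; rewrite size_tuple gdist_ladder.
by exists (Ordinal ltm); apply/eqP/val_inj/val_inj.
Qed.

Lemma ladder_path_adj :
  {mono ladder_path : m n / @adj (path_graph k) m n
    >-> @adj (shortest_path_graph source target) m n}.
Proof.
move=> m n; rewrite /= /sp_adj (card_tnth_neq _ _ source) /=.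
(* Three terms remain: even endpoints, odd endpoints, and [target] against itself, which gives 0.
   The first two add up to 0, 1 or 2 according as [m] and [n] are equal, consecutive or further
   apart. *)
rewrite gdist_ladder !big_ord_recl big_ord0 /= /path_adj.
have E i j : ((inl i : ladder) == inl j) = (i == j) by [].
move: (ltn_ord m) (ltn_ord n) => ltm ltn.
by rewrite !E -!val_eqE /= !inordK; lia.
Qed.

End Ladder.

Theorem lemma4 (k : nat) (hk : 1 <= k) :
  is_shortest_path_graph (path_graph k).
Proof.
exists (ladder k), (source k), (target k); split=> //.
(* The isomorphism has to start from the shortest paths, so [ladder_path] is inverted by choosing
   preimages. *)
pose index p := xchoose (ladder_path_surj k p).
have indexK : cancel index (ladder_path k).
  by move=> p; apply/eqP; exact: xchooseP (ladder_path_surj k p).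
exists index; split; last first.
  by move=> p q; rewrite -(ladder_path_adj k) !indexK.
by exists (ladder_path k) => // m; apply: ladder_path_inj; rewrite indexK.
Qed.
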